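(* For all $n,k\in\mathbb{N}$, the poset $I_n[k]$ has the strong Sperner property and is rank-log concave.
   Context: Let $[n]=\{1,\dots,n\}$ and $[n']=\{1',\dots,n'\}$ (a disjoint copy). The poset of isotropic flags $I_n$ is the set of all subsets of $[n]\sqcup[n']$ containing no pair $\{i,i'\}$ for any $i$, ordered by inclusion. For a poset $(P,\leq)$ and $k\in\mathbb{N}$, $P[k] = \{(x_1 \leq x_2 \leq \dotsb \leq x_k) \mid x_i \in P\}$ (multichains, repetitions allowed), ordered by $(x_1 \leq \dotsb \leq x_k) \leq_k (x'_1 \leq \dotsb \leq x'_k)$ iff $x_i \leq x'_i$ for all $i$; it is graded with rank $\rho(x_1\le\dots\le x_k)=\sum_i\rho(x_i)$, ranks starting at $0$ on minimal elements. For a graded poset $P$ of rank $n$ let $P_i=\{x\in P:\rho(x)=i\}$. $P$ is rank-log concave if $|P_i|^2\geq |P_{i-1}||P_{i+1}|$ for $i=1,\dots,n-1$. $P$ has the $m$-Sperner property if no union of $m$ antichains of $P$ has more elements than the union of the $m$ largest levels $P_i$; it has the strong Sperner property if it has the $m$-Sperner property for all $m\in\mathbb{N}$. *)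

(* Defs.v *)
From HB Require Import structures.
From mathcomp Require Import all_boot all_order.
Set Implicit Arguments.
Unset Strict Implicit.
Unset Printing Implicit Defensive.
Import Order.TTheory.
Local Open Scope order_scope.

Section Poset.
Context {d : Order.disp_t} {P : finPOrderType d}.
Implicit Types (x y : P) (A : {set P}).

Definition minimal x : Prop := forall y, y <= x -> y = x.
Definition maximal x : Prop := forall y, x <= y -> y = x.
Definition covers x y : Prop := x < y /\ forall z, x <= z -> z <= y -> z = x \/ z = y.
Definition antichain A : Prop := {in A &, forall x y, x <= y -> x = y}.

Lemma exists_cover x y : x < y -> exists2 z, covers x z & z <= y.
Proof.
move=> lt_xy; pose B z := (x < z <= y)%O.
have By : B y by rewrite /B lt_xy lexx.
case: (@arg_minnP _ y B (fun z => #|[set w | w <= z]|) By) => z /andP[xz zy] zmin.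
exists z => //; split=> // w xw wz.
have [->|nxw] := eqVneq w x; [by left | right].
apply/eqP; apply: contraT => nwz.
have Bw : B w by rewrite /B lt_neqAle eq_sym nxw xw (le_trans wz).
have := zmin w Bw; rewrite leqNgt => /negP[]; apply: proper_card.
apply/properP; split; first by apply/subsetP=> u; rewrite !inE => /le_trans; apply.
by exists z; rewrite !inE ?lexx //; apply: contra nwz => zw; rewrite eq_le wz zw.
Qed.

End Poset.

(* A finite graded poset: the rank starts at 0 on minimal elements, increases
   by one along covers, and is the same at all maximal elements; equivalently,
   all maximal chains have the same length. *)
HB.mixin Record isGraded (d : Order.disp_t) P & Order.FinPOrder d P := {
  prank : P -> nat;
  prank_minimal : forall x : P, minimal x -> prank x = 0%N;
  prank_covers : forall x y : P, covers x y -> prank y = (prank x).+1;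
  prank_maximal : forall x : P, maximal x -> prank x = \max_(y : P) prank y
}.

#[short(type="gradedPosetType")]
HB.structure Definition GradedPoset (d : Order.disp_t) :=
  { P of Order.FinPOrder d P & isGraded d P }.

Section Sperner.
Context {d : Order.disp_t} (P : gradedPosetType d).

Definition height : nat := \max_(x : P) prank x.

Definition level (i : nat) : {set P} := [set x | prank x == i].

Definition rank_log_concave : Prop :=
  forall i : nat, (0 < i < height)%N ->
    (#|level i.-1| * #|level i.+1| <= #|level i| ^ 2)%N.

Definition levels_by_size : seq {set P} :=
  sort (fun A B : {set P} => (#|B| <= #|A|)%N)
       [seq level i | i <- iota 0 height.+1].

(* When m exceeds the number of levels, [take] keeps all of them. *)
Definition largest_levels (m : nat) : {set P} :=
  \bigcup_(L <- take m levels_by_size) L.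

Definition sperner (m : nat) : Prop :=
  forall A : 'I_m -> {set P}, (forall j, antichain (A j)) ->
    (#|\bigcup_(j < m) A j| <= #|largest_levels m|)%N.

Definition strong_sperner : Prop := forall m : nat, sperner m.

End Sperner.

Section Multichain.
Context {d : Order.disp_t}.

Record multichain (P : finPOrderType d) (k : nat) := Multichain {
  mc_val : k.-tuple P;
  _ : sorted <=%O mc_val
}.

HB.instance Definition _ (P : finPOrderType d) k :=
  [isSub for @mc_val P k].
HB.instance Definition _ (P : finPOrderType d) k :=
  [Finite of multichain P k by <:].

Definition mc_nth (P : finPOrderType d) k (c : multichain P k) (i : 'I_k) : P :=
  tnth (mc_val c) i.

Definition mc_le (P : finPOrderType d) k (c1 c2 : multichain P k) : bool :=
  [forall i : 'I_k, mc_nth c1 i <= mc_nth c2 i].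

Section Order.
Variables (P : finPOrderType d) (k : nat).
Implicit Types c : multichain P k.

Lemma mc_le_refl : reflexive (@mc_le P k).
Proof. by move=> c; apply/forallP. Qed.

Lemma mc_le_anti : antisymmetric (@mc_le P k).
Proof.
move=> c1 c2 /andP[/forallP h1 /forallP h2]; apply: val_inj.
by apply: eq_from_tnth => i; apply: le_anti; rewrite [X in X && _]h1 [X in _ && X]h2.
Qed.

Lemma mc_le_trans : transitive (@mc_le P k).
Proof.
move=> c2 c1 c3 /forallP h1 /forallP h2; apply/forallP => i.
exact: le_trans (h1 i) (h2 i).
Qed.

HB.instance Definition _ := Order.Le_isPOrder.Build d (multichain P k)
  mc_le_refl mc_le_anti mc_le_trans.

Lemma mc_leP c1 c2 :
  reflect (forall i, mc_nth c1 i <= mc_nth c2 i) (c1 <= c2).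
Proof. exact: forallP. Qed.

Lemma mc_nth_inj c1 c2 : (forall i, mc_nth c1 i = mc_nth c2 i) -> c1 = c2.
Proof. by move=> e; apply: val_inj; apply: eq_from_tnth. Qed.

Lemma mc_nth_homo c (i j : 'I_k) : (i <= j)%N -> mc_nth c i <= mc_nth c j.
Proof.
move=> ij; case: c => t st; rewrite /mc_nth /=.
have tr : transitive (<=%O : rel P) by exact: le_trans.
have rf : reflexive (<=%O : rel P) by exact: lexx.
rewrite (tnth_nth (tnth t i) t j) [leLHS](tnth_nth (tnth t i) t i).
by apply: (sorted_leq_nth tr rf _ st); rewrite ?inE ?size_tuple.
Qed.

Lemma mk_sorted (f : 'I_k -> P) :
  (forall i j : 'I_k, (i <= j)%N -> f i <= f j) ->
  sorted <=%O [tuple f i | i < k].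
Proof.
move=> fH; case: k f fH => [|k'] f fH; first by rewrite tuple0.
apply/(sortedP (f ord0)) => i; rewrite size_tuple => lti.
rewrite -[i]/(nat_of_ord (Ordinal (ltnW lti))) -[(i.+1)]/(nat_of_ord (Ordinal lti)).
by rewrite -!tnth_nth !tnth_mktuple fH /=.
Qed.

Definition mk_mc f fH : multichain P k := Multichain (@mk_sorted f fH).

Lemma mk_mcE f fH i : mc_nth (@mk_mc f fH) i = f i.
Proof. by rewrite /mc_nth tnth_mktuple. Qed.

Definition const_mc (x : P) : multichain P k := mk_mc (fun _ _ _ => lexx x).

Lemma const_mcE x i : mc_nth (const_mc x) i = x.
Proof. exact: mk_mcE. Qed.

End Order.

Section Graded.
Variables (P : gradedPosetType d) (k : nat).
Implicit Types c : multichain P k.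

Definition mc_rank c : nat := \sum_(i < k) prank (mc_nth c i).

Lemma mc_rank_minimal c : minimal c -> mc_rank c = 0%N.
Proof.
move=> cmin; apply: big1 => i _; apply: prank_minimal => y yc.
have k0 : (0 < k)%N by apply: leq_ltn_trans (ltn_ord i).
have e0 : const_mc k (mc_nth c (Ordinal k0)) = c.
  by apply: cmin; apply/mc_leP => j; rewrite const_mcE mc_nth_homo.
have eE j : mc_nth c j = mc_nth c (Ordinal k0) by rewrite -{1}e0 const_mcE.
have : const_mc k y = c.
  by apply: cmin; apply/mc_leP => j; rewrite const_mcE eE -(eE i).
by move <-; rewrite const_mcE.
Qed.

Lemma mc_rank_maximal c : maximal c ->
  mc_rank c = \max_(c' : multichain P k) mc_rank c'.
Proof.
move=> cmax.
have cE i : prank (mc_nth c i) = height P.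
  apply: prank_maximal => y cy.
  have k0 : (k.-1 < k)%N by rewrite prednK //; apply: leq_ltn_trans (ltn_ord i).
  have e0 : const_mc k (mc_nth c (Ordinal k0)) = c.
    apply: cmax; apply/mc_leP => j; rewrite const_mcE mc_nth_homo //=.
    by rewrite -ltnS prednK //; apply: leq_ltn_trans (ltn_ord i).
  have eE j : mc_nth c j = mc_nth c (Ordinal k0) by rewrite -{1}e0 const_mcE.
  have : const_mc k y = c.
    by apply: cmax; apply/mc_leP => j; rewrite const_mcE eE -(eE i).
  by move <-; rewrite const_mcE.
apply/eqP; rewrite eqn_leq (leq_bigmax c) /=; apply/bigmax_leqP => c' _.
rewrite /mc_rank (eq_bigr _ (fun i _ => cE i)); apply: leq_sum => i _.
exact: (leq_bigmax (mc_nth c' i)).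
Qed.

Lemma mc_rank_covers c1 c2 : covers c1 c2 -> mc_rank c2 = (mc_rank c1).+1.
Proof.
case=> c12 cov; have /mc_leP le12 := ltW c12.
have [i0 ne0] : exists i, mc_nth c1 i != mc_nth c2 i.
  apply/existsP; apply: contraT => /existsPn h; rewrite -(ltxx c1).
  have {2}-> // : c1 = c2.
  by apply: mc_nth_inj => i; apply/eqP; have := h i; rewrite negbK.
case: (@arg_maxnP _ i0 (fun i => mc_nth c1 i != mc_nth c2 i) (fun i : 'I_k => i : nat) ne0) => i nei imax.
have lti : mc_nth c1 i < mc_nth c2 i by rewrite lt_neqAle nei le12.
have [z [lt1z covz] lez2] := exists_cover lti.
have fH (a b : 'I_k) : (a <= b)%N ->
  (if a == i then z else mc_nth c1 a) <= (if b == i then z else mc_nth c1 b).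
  move=> ab; case: eqVneq => [ea|nea]; case: eqVneq => [eb|neb] //.
  - have ltib : (i < b)%N by rewrite ltn_neqAle -ea ab andbT ea eq_sym.
    have /eqP-> : mc_nth c1 b == mc_nth c2 b.
      by apply: contraTT ltib => /imax; rewrite -leqNgt.
    by rewrite (le_trans lez2) // mc_nth_homo // ltnW.
  - by rewrite (le_trans _ (ltW lt1z)) // mc_nth_homo // -eb.
  - exact: mc_nth_homo.
pose w := mk_mc fH.
have wE j : mc_nth w j = if j == i then z else mc_nth c1 j by rewrite mk_mcE.
have w1 : c1 <= w.
  by apply/mc_leP => j; rewrite wE; case: eqP => [->|]; rewrite ?(ltW lt1z).
have w2 : w <= c2.
  by apply/mc_leP => j; rewrite wE; case: eqP => [->|].
case: (cov w w1 w2) => [ew|<-].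
  by have := wE i; rewrite eqxx ew => e; rewrite e ltxx in lt1z.
rewrite /mc_rank (bigD1 i) //= [in RHS](bigD1 i) //= wE eqxx.
rewrite (prank_covers _ _ (conj lt1z covz)) addSn.
by congr (_ + _).+1; apply: eq_bigr => j /negbTE ji; rewrite wE ji.
Qed.

HB.instance Definition _ := isGraded.Build d (multichain P k)
  mc_rank_minimal mc_rank_covers mc_rank_maximal.

End Graded.
End Multichain.

Section Isotropic.
Variable n : nat.

(* [inl i] stands for the element i of [n], and [inr i] for i' of [n']. *)
Definition isotropic (A : {set 'I_n + 'I_n}) : bool :=
  [forall i : 'I_n, ~~ ((inl i \in A) && (inr i \in A))].

Record isoFlag := IsoFlag {
  iso_set : {set 'I_n + 'I_n};
  _ : isotropic iso_set
}.

HB.instance Definition _ := [isSub for iso_set].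
HB.instance Definition _ := [Finite of isoFlag by <:].

Definition iso_le (x y : isoFlag) : bool := iso_set x \subset iso_set y.

Lemma iso_le_refl : reflexive iso_le.
Proof. by move=> x; apply: subxx. Qed.

Lemma iso_le_anti : antisymmetric iso_le.
Proof. by move=> x y xy; apply/val_inj/eqP; rewrite eqEsubset. Qed.

Lemma iso_le_trans : transitive iso_le.
Proof. by move=> y x z; apply: subset_trans. Qed.

HB.instance Definition _ := Order.Le_isPOrder.Build (Order.Disp tt tt) isoFlag
  iso_le_refl iso_le_anti iso_le_trans.

Lemma iso_leE (x y : isoFlag) : (x <= y) = (iso_set x \subset iso_set y).
Proof. by []. Qed.

Lemma iso_setP (x : isoFlag) : isotropic (iso_set x).
Proof. by case: x. Qed.

Lemma isotropicS (A B : {set 'I_n + 'I_n}) :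
  A \subset B -> isotropic B -> isotropic A.
Proof.
move=> /subsetP AB /forallP iB; apply/forallP => i; apply: contra (iB i).
by case/andP=> h1 h2; rewrite !AB.
Qed.

Definition iso_rank (x : isoFlag) : nat := #|iso_set x|.

Lemma iso_rank_minimal x : minimal x -> iso_rank x = 0%N.
Proof.
have i0 : isotropic set0 by apply/forallP => i; rewrite !inE.
by move/(_ (IsoFlag i0)); rewrite iso_leE sub0set => <- //; rewrite /iso_rank cards0.
Qed.

Lemma iso_rank_covers x y : covers x y -> iso_rank y = (iso_rank x).+1.
Proof.
case=> xy cov; have sxy : iso_set x \subset iso_set y by rewrite -iso_leE ltW.
have [a ay ax] : exists2 a, a \in iso_set y & a \notin iso_set x.
  apply/subsetPn; rewrite -iso_leE; apply/negP => yx.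
  by have := lt_le_trans xy yx; rewrite ltxx.
have sA : a |: iso_set x \subset iso_set y by rewrite subUset sub1set ay.
pose w := IsoFlag (isotropicS sA (iso_setP y)).
case: (cov w); rewrite ?iso_leE ?subsetUr //.
  by move=> ew; move: ax; rewrite -ew setU11.
by move <-; rewrite /iso_rank cardsU1 ax.
Qed.

Let proj (a : 'I_n + 'I_n) : 'I_n := match a with inl i => i | inr i => i end.

Lemma proj_inj x : {in iso_set x &, injective proj}.
Proof.
move=> a b; have /forallP h := iso_setP x.
case: a => i; case: b => j ha hb /= e; rewrite ?e //.
all: by have := h j; rewrite -{1}e ?ha ?hb // e in ha * => /negP[]; rewrite ?ha ?hb.
Qed.

Lemma iso_rank_maximal x : maximal x -> iso_rank x = \max_(y : isoFlag) iso_rank y.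
Proof.
have le_n y : (iso_rank y <= n)%N.
  by rewrite /iso_rank -(card_in_imset (@proj_inj y)) -[leqRHS]card_ord max_card.
move=> xmax; apply/eqP; rewrite eqn_leq (leq_bigmax x) /=.
apply/bigmax_leqP => y _; apply: leq_trans (le_n y) _.
rewrite /iso_rank -(card_in_imset (@proj_inj x)) -[leqLHS]card_ord -cardsT.
apply/subset_leq_card/subsetP => i _; apply: contraT => ni.
have nl : inl i \notin iso_set x by apply: contra ni => h; apply/imsetP; exists (inl i).
have nr : inr i \notin iso_set x by apply: contra ni => h; apply/imsetP; exists (inr i).
have iA : isotropic (inl i |: iso_set x).
  apply/forallP => j; have /forallP/(_ j) := iso_setP x; rewrite !inE.
  have [-> _|nji] := eqVneq j i; first by rewrite (negbTE nr) !andbF.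
  by have -> // : (inl j == inl i :> 'I_n + 'I_n) = false; apply/negP => /eqP[]; apply/eqP.
have := xmax (IsoFlag iA); rewrite iso_leE subsetUr => /(_ isT) e.
by move: nl; rewrite -e setU11.
Qed.

HB.instance Definition _ := isGraded.Build _ isoFlag
  iso_rank_minimal iso_rank_covers iso_rank_maximal.

End Isotropic.

(* Main.v *)
Require Import Defs.
From mathcomp Require Import all_boot all_order.
From mathcomp Require Import all_algebra zify lra ring.
Set Implicit Arguments.
Unset Strict Implicit.
Unset Printing Implicit Defensive.
Import Order.TTheory GRing.Theory Num.Theory.
Local Open Scope ring_scope.

(* A multichain of isotropic flags amounts to choosing, for each i in [n], how
   many of its members contain i and how many contain i', one of the two numbers
   being 0. Hence I_n[k] is the n-th power of the spider obtained by gluing two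
   chains of length k at their bottom. The spider has log-concave level sizes and
   the normalized matching property, and by Harper's theorem both pass to
   products. The normalized matching property gives the LYM inequality for
   antichains, from which the strong Sperner property follows by comparing a
   union of m antichains with the m largest levels. *)

(** * Level sizes and their 2x2 minors *)

(* The Toeplitz matrix of the level sizes: [rcount r a l] is the size of level
   [l - a], and [0] when [l < a]. *)
Definition rcount (X : finType) (r : X -> nat) (a l : nat) : nat :=
  (\sum_(x : X) (a + r x == l))%N.

(* All 2x2 minors are nonnegative. For [rcount r], this is log-concavity of the
   level sizes together with the absence of internal zeros. *)
Definition tp2 (g : nat -> nat -> nat) : Prop :=
  forall a b i j, (a <= b)%N -> (i <= j)%N ->
    (g b i * g a j <= g a i * g b j)%N.

Lemma rcountE (X : finType) (r : X -> nat) a l :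
  rcount r a l = if (a <= l)%N then rcount r 0 (l - a) else 0%N.
Proof.
case: leqP => al; last by apply: big1 => x _; apply/eqP; rewrite eqb0; lia.
by apply: eq_bigr => x _; congr nat_of_bool; lia.
Qed.

Lemma rcount_gt0 (X : finType) (r : X -> nat) x : (0 < rcount r 0 (r x))%N.
Proof. by rewrite /rcount (bigD1 x) //= add0n eqxx. Qed.

(** The Cauchy-Binet formula for 2x2 minors, summed over ordered pairs: each unordered pair occurs
    twice, hence the factor 2. *)
Lemma cauchy_binet2 (R : comPzRingType) (I : finType) (f1 f2 g1 g2 : I -> R) :
  ((\sum_a f1 a * g1 a) * (\sum_b f2 b * g2 b)
   - (\sum_a f1 a * g2 a) * (\sum_b f2 b * g1 b)) *+ 2
  = \sum_a \sum_b (f1 a * f2 b - f2 a * f1 b) * (g1 a * g2 b - g2 a * g1 b).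
Proof.
pose S h k := \sum_(a : I) \sum_(b : I) (h a : R) * k b.
have Sc h k : S h k = S k h.
  by rewrite /S exchange_big; apply: eq_bigr => a _; apply: eq_bigr => b _; exact: mulrC.
pose m (f g : I -> R) a := f a * g a.
transitivity (S (m f1 g1) (m f2 g2) - S (m f1 g2) (m f2 g1)
              - S (m f2 g1) (m f1 g2) + S (m f2 g2) (m f1 g1)).
  by rewrite (Sc (m f2 g1)) (Sc (m f2 g2)) /S -!big_distrlr /=; ring.
rewrite /S -!sumrB -big_split /=; apply: eq_bigr => a _.
by rewrite -!sumrB -big_split /=; apply: eq_bigr => b _; rewrite /m; ring.
Qed.

(** In each Cauchy-Binet term the minors of [f] and [g] have the same sign: nonnegative for
    [a <= b], nonpositive otherwise. *)
Lemma tp2_mul (f g h : nat -> nat -> nat) :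
  tp2 f -> tp2 g ->
  (forall e l m, (l < m)%N -> h e l = \sum_(a < m) f e a * g a l)%N -> tp2 h.
Proof.
move=> tf tg hE e e' i j ee' ij; rewrite !(hE _ _ j.+1) // -(ler_nat rat).
rewrite !natrM !natr_sum !(eq_bigr _ (fun a _ => natrM _ _ _)).
rewrite -subr_ge0 -(@pmulrn_lge0 _ _ 2) // [X in _ - X]mulrC cauchy_binet2.
apply: sumr_ge0 => a _; apply: sumr_ge0 => b _; rewrite -!natrM.
have [ab|/ltnW ba] := leqP a b.
  by have := tf _ _ _ _ ee' ab; have := tg _ _ _ _ ab ij => *;
    apply: mulr_ge0; rewrite subr_ge0 ler_nat; lia.
by have := tf _ _ _ _ ee' ba; have := tg _ _ _ _ ba ij => *;
  apply: mulr_le0; rewrite subr_le0 ler_nat; lia.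
Qed.

(** Level sizes of a product convolve, which multiplies the Toeplitz matrices; cutting the sum at
    [m] is harmless since [rcount s a l] vanishes for [a > l]. *)
Lemma rcount_prod (X Y : finType) (r : X -> nat) (s : Y -> nat) e l m :
  (l < m)%N ->
  rcount (fun p : X * Y => r p.1 + s p.2)%N e l =
  (\sum_(a < m) rcount r e a * rcount s a l)%N.
Proof.
move=> lm; under [RHS]eq_bigr do rewrite /rcount big_distrlr /=.
rewrite /rcount -(pair_bigA _ (fun x y => (e + (r x + s y) == l) : nat)) /=.
rewrite [RHS]exchange_big; apply: eq_bigr => x _.
rewrite [RHS]exchange_big; apply: eq_bigr => y _.
have [xm|xm] := ltnP (e + r x) m.
  rewrite (bigD1 (Ordinal xm)) //= eqxx mul1n big1 ?addn0 -?addnA // => a.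
  by move=> /negbTE na; rewrite eq_sym -(inj_eq val_inj) /= in na; rewrite na.
rewrite big1 => [|a _]; first by apply/eqP; rewrite eqb0; lia.
by apply/eqP; rewrite muln_eq0 !eqb0; have := ltn_ord a; lia.
Qed.

Lemma tp2_prod (X Y : finType) (r : X -> nat) (s : Y -> nat) :
  tp2 (rcount r) -> tp2 (rcount s) ->
  tp2 (rcount (fun p : X * Y => r p.1 + s p.2)%N).
Proof. by move=> tr ts; apply: (tp2_mul tr ts) => e l m; apply: rcount_prod. Qed.

(** * Distribution of the first rank on a level of a product *)

Section Below.
Variables (X Y : finType) (r : X -> nat) (s : Y -> nat).

Definition pair_total (l : nat) : nat := (\sum_x \sum_y (r x + s y == l))%N.

Definition below (i l : nat) : nat :=
  (\sum_x \sum_y ((r x < i) && (r x + s y == l)))%N.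

Lemma pair_total_prod l :
  pair_total l = rcount (fun p : X * Y => r p.1 + s p.2)%N 0 l.
Proof. exact: pair_bigA. Qed.

Lemma below_rcount i l : below i l = (\sum_(x | (r x < i)%N) rcount s (r x) l)%N.
Proof.
rewrite [RHS]big_mkcond; apply: eq_bigr => x _.
by case: (r x < i)%N => //; apply: big1.
Qed.

Lemma pair_total_rcount i l :
  pair_total l = (below i l + \sum_(x | ~~ (r x < i)%N) rcount s (r x) l)%N.
Proof. by rewrite below_rcount -(bigID (fun x => (r x < i)%N) predT). Qed.

(** After cancelling the common term, each pair with [r x < i <= r y] contributes a 2x2 minor of
    [rcount s]. *)
Lemma below_ratio i l : tp2 (rcount s) ->
  (below i l.+1 * pair_total l <= below i l * pair_total l.+1)%N.
Proof.
move=> ts; rewrite !(pair_total_rcount i) !mulnDr mulnC leq_add2l.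
rewrite !below_rcount !big_distrlr /=; apply: leq_sum => x xi.
by apply: leq_sum => y yi; rewrite mulnC; apply: ts; lia.
Qed.

End Below.

Section BelowSum.
Variables (X Y : finType) (r : X -> nat) (s : Y -> nat).

Lemma pair_totalC l : pair_total s r l = pair_total r s l.
Proof.
rewrite /pair_total exchange_big; apply: eq_bigr => x _; apply: eq_bigr => y _.
by rewrite addnC.
Qed.

(** As [i + j = l + 1], a pair on level [l] satisfies exactly one of [r x < i] and [s y < j]. *)
Lemma below_sum i j l : (i + j = l.+1)%N ->
  (below r s i l + below s r j l = pair_total r s l)%N.
Proof.
move=> e; rewrite [X in (_ + X)%N]exchange_big -big_split; apply: eq_bigr => x _.
by rewrite -big_split; apply: eq_bigr => y _ /=; lia.
Qed.

Let levels_prod i j : (rcount r 0 i * rcount s 0 j =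
  \sum_x \sum_y ((r x == i) * (s y == j)))%N.
Proof. exact: big_distrlr. Qed.

(** On level [i + j] at least one of [r x <= i] and [s y <= j] holds, and both hold only at ranks
    [(i, j)]. *)
Lemma below_sum_source i j :
  (below r s i.+1 (i + j) + below s r j.+1 (i + j) =
   pair_total r s (i + j) + rcount r 0 i * rcount s 0 j)%N.
Proof.
rewrite levels_prod [X in (_ + X)%N]exchange_big -!big_split.
apply: eq_bigr => x _; rewrite -!big_split; apply: eq_bigr => y _ /=.
by rewrite mulnb; lia.
Qed.

Lemma below_sum_target i j :
  (below r s i (i + j) + below s r j (i + j) + rcount r 0 i * rcount s 0 j =
   pair_total r s (i + j))%N.
Proof.
rewrite levels_prod [X in (_ + X + _)%N]exchange_big -!big_split.
apply: eq_bigr => x _; rewrite -!big_split; apply: eq_bigr => y _ /=.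
by rewrite mulnb; lia.
Qed.

End BelowSum.

(* The decrease, from level [l] to level [l + 1] of the product, of the proportion
   of pairs whose first rank is less than [i]: the amount of mass that has to be
   moved from first rank [i - 1] to first rank [i]. *)
Definition below_drop (X Y : finType) (r : X -> nat) (s : Y -> nat) (i l : nat) : rat :=
  (below r s i l)%:R / (pair_total r s l)%:R
  - (below r s i l.+1)%:R / (pair_total r s l.+1)%:R.

Lemma below_drop_ge0 (X Y : finType) (r : X -> nat) (s : Y -> nat) i l :
  tp2 (rcount s) -> (0 < pair_total r s l)%N -> 0 <= below_drop r s i l.
Proof.
move=> ts tl; rewrite subr_ge0.
(* If level [l + 1] is empty, the subtracted quotient is 0 by the convention on division by 0. *)
have [->|] := posnP (pair_total r s l.+1); first by rewrite invr0 mulr0 divr_ge0.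
move=> tl'; rewrite ler_pdivrMr ?ltr0n // mulrAC ler_pdivlMr ?ltr0n //.
by rewrite -!natrM ler_nat below_ratio.
Qed.

Lemma below_drop0 (X Y : finType) (r : X -> nat) (s : Y -> nat) l : below_drop r s 0 l = 0.
Proof. by rewrite /below_drop !below_rcount !big_pred0_eq !mul0r subrr. Qed.

(** Mass balance: what leaves ranks [(i, j)] by raising either coordinate is the share of these
    ranks in level [i + j]. *)
Lemma below_drop_source (X Y : finType) (r : X -> nat) (s : Y -> nat) i j :
  (0 < pair_total r s (i + j))%N -> (0 < pair_total r s (i + j).+1)%N ->
  below_drop r s i.+1 (i + j) + below_drop s r j.+1 (i + j) =
  (rcount r 0 i)%:R * (rcount s 0 j)%:R / (pair_total r s (i + j))%:R.
Proof.
rewrite /below_drop !(pair_totalC r s) => t0 t1.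
have := below_sum_source r s i j.
have /eqP := @below_sum _ _ r s i.+1 j.+1 (i + j).+1 ltac:(lia).
rewrite -!(eqr_nat rat) natrD => /eqP e1 /(congr1 (fun n => n%:R : rat)).
rewrite !natrD natrM => e2.
have n0 : (pair_total r s (i + j))%:R != 0 :> rat by rewrite pnatr_eq0; lia.
have n1 : (pair_total r s (i + j).+1)%:R != 0 :> rat by rewrite pnatr_eq0; lia.
rewrite addrACA -opprD -!mulrDl e1 e2 divff //.
by rewrite mulrDl divff // addrAC subrr add0r.
Qed.

(** The matching balance for the mass arriving at ranks [(i, j)]. *)
Lemma below_drop_target (X Y : finType) (r : X -> nat) (s : Y -> nat) i j l :
  (i + j = l.+1)%N -> (0 < pair_total r s l)%N -> (0 < pair_total r s l.+1)%N ->
  below_drop r s i l + below_drop s r j l =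
  (rcount r 0 i)%:R * (rcount s 0 j)%:R / (pair_total r s l.+1)%:R.
Proof.
move=> e; rewrite /below_drop !(pair_totalC r s) => t0 t1.
have /(congr1 (fun n => n%:R : rat)) := below_sum_target r s i j.
have /(congr1 (fun n => n%:R : rat)) := below_sum r s e.
rewrite e !natrD natrM => e1 e2.
have n0 : (pair_total r s l)%:R != 0 :> rat by rewrite pnatr_eq0; lia.
have n1 : (pair_total r s l.+1)%:R != 0 :> rat by rewrite pnatr_eq0; lia.
rewrite addrACA -opprD -!mulrDl e1 divff //; apply: (mulIf n1).
by rewrite mulrBl !divfK // mul1r -e2 [LHS]addrC addKr.
Qed.

(** * Flows between consecutive levels and their products *)

(* [F] is the joint law of two consecutive steps of a random chain that is uniform
   on each level, a weighted form of the normalized matching property. Only the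
   two inequalities on the marginals are needed, and they hold trivially at the
   last and at the first level. *)
Record flow (X : finType) (le : rel X) (r : X -> nat) (F : X -> X -> rat) : Prop :=
  Flow {
    flow_ge0 : forall x y, 0 <= F x y;
    flow_supp : forall x y, F x y != 0 -> le x y /\ r y = (r x).+1;
    flow_row : forall x, \sum_y F x y <= (rcount r 0 (r x))%:R^-1;
    flow_col : forall y, (0 < r y)%N -> (rcount r 0 (r y))%:R^-1 <= \sum_x F x y
  }.

(** The column bound makes the inflow at [y] positive. Hence no level below an occupied one is
    empty. *)
Lemma flow_pred (X : finType) (le : rel X) (r : X -> nat) F y :
  flow le r F -> (0 < r y)%N -> exists2 x, le x y & r y = (r x).+1.
Proof.
move=> fF y0; have : 0 < \sum_x F x y.
  by apply: lt_le_trans (flow_col fF y0); rewrite invr_gt0 ltr0n rcount_gt0.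
rewrite lt0r => /andP[/eqP n0 _].
have [x Fx|F0] := pickP (fun x => F x y != 0).
  by have [] := flow_supp fF Fx; exists x.
by case: n0; apply: big1 => x _; apply/eqP; rewrite -[_ == _]negbK F0.
Qed.

Lemma sum_fst_eq (X Y : finType) (H : X * Y -> rat) x :
  \sum_q (if q.1 == x then H q else 0) = \sum_y H (x, y).
Proof.
rewrite (eq_bigr (fun q => if q.1 == x then H (q.1, q.2) else 0)); last by case.
rewrite -(pair_bigA _ (fun z y => if z == x then H (z, y) else 0)) exchange_big.
by apply: eq_bigr => y _; rewrite -big_mkcond big_pred1_eq.
Qed.

Lemma sum_snd_eq (X Y : finType) (H : X * Y -> rat) y :
  \sum_q (if q.2 == y then H q else 0) = \sum_x H (x, y).
Proof.
rewrite (eq_bigr (fun q => if q.2 == y then H (q.1, q.2) else 0)); last by case.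
rewrite -(pair_bigA _ (fun x v => if v == y then H (x, v) else 0)) /=.
by apply: eq_bigr => x _; rewrite -big_mkcond big_pred1_eq.
Qed.

Section FlowProd.
Variables (X Y : finType) (leX : rel X) (leY : rel Y).
Variables (r : X -> nat) (s : Y -> nat) (F : X -> X -> rat) (G : Y -> Y -> rat).
Hypotheses (reflX : reflexive leX) (reflY : reflexive leY).
Hypotheses (tr : tp2 (rcount r)) (ts : tp2 (rcount s)).
Hypotheses (fF : flow leX r F) (fG : flow leY s G).

Let rk (p : X * Y) := (r p.1 + s p.2)%N.
(** The mass passing to first rank [r q.1] is spread along [F] in the first coordinate and uniformly
    over the second coordinates of rank [s p.2]; [right] is the mirror image. *)
Let left (p q : X * Y) :=
  F p.1 q.1 * (below_drop r s (r q.1) (rk p) / (rcount s 0 (s p.2))%:R).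
Let right (p q : X * Y) :=
  G p.2 q.2 * (below_drop s r (s q.2) (rk p) / (rcount r 0 (r p.1))%:R).

(* The first ranks on two consecutive levels of the product are coupled
   monotonically, so each move changes one coordinate, along the flow there. *)
Definition flow_prod (p q : X * Y) : rat :=
  (if p.2 == q.2 then left p q else 0) + (if p.1 == q.1 then right p q else 0).

Let total_rk p : (0 < pair_total r s (rk p))%N.
Proof. by rewrite pair_total_prod rcount_gt0. Qed.

Let left_ge0 p q : 0 <= left p q.
Proof.
rewrite mulr_ge0 ?(flow_ge0 fF) // divr_ge0 //; apply: below_drop_ge0 => //.
Qed.

Let right_ge0 p q : 0 <= right p q.
Proof.
rewrite mulr_ge0 ?(flow_ge0 fG) // divr_ge0 //; apply: below_drop_ge0 => //.
by rewrite pair_totalC.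
Qed.

Lemma flow_prod_supp p q : flow_prod p q != 0 ->
  (leX p.1 q.1 && leY p.2 q.2) /\ rk q = (rk p).+1.
Proof.
case: p q => [x u] [y v]; rewrite /flow_prod /left /right /rk /=.
have [<-|_] := eqVneq u v.
  have [->|/(flow_supp fF)[-> ->]] := eqVneq (F x y) 0; last by rewrite reflY addSn.
  (* [G u u] must vanish, because the support of a flow raises the rank. *)
  have [->|/(flow_supp fG)[_]] := eqVneq (G u u) 0; last by lia.
  by rewrite !mul0r if_same addr0 eqxx.
have [<-|_] := eqVneq x y; last by rewrite addr0 eqxx.
have [->|/(flow_supp fG)[-> ->]] := eqVneq (G u v) 0; last by rewrite reflX addnS.
by rewrite mul0r addr0 eqxx.
Qed.

Lemma flow_prodP :
  flow (fun p q : X * Y => leX p.1 q.1 && leY p.2 q.2)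
       (fun p => r p.1 + s p.2)%N flow_prod.
Proof.
split => [p q|p q|[x u]|[y v]].
- by apply: addr_ge0; case: ifP.
- exact: flow_prod_supp.
- rewrite -pair_total_prod.
  (* The mass balance requires a nonempty next level; without one, nothing flows out. *)
  have [t0|t0] := posnP (pair_total r s (rk (x, u)).+1).
    rewrite big1 ?invr_ge0 // => q _; apply/eqP; apply: contraTT isT.
    by case/flow_prod_supp => _ e; have := total_rk q; rewrite e t0.
  rewrite big_split /=.
  under eq_bigr do rewrite eq_sym; rewrite sum_snd_eq.
  under [X in _ + X]eq_bigr do rewrite eq_sym; rewrite sum_fst_eq.
  have -> : \sum_y left (x, u) (y, u) = (\sum_y F x y) *
      (below_drop r s (r x).+1 (r x + s u) / (rcount s 0 (s u))%:R).
    rewrite mulr_suml; apply: eq_bigr => y _; rewrite /left /=.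
    by have [->|/(flow_supp fF)[_ ->]] := eqVneq (F x y) 0; rewrite ?mul0r.
  have -> : \sum_v right (x, u) (x, v) = (\sum_v G u v) *
      (below_drop s r (s u).+1 (r x + s u) / (rcount r 0 (r x))%:R).
    rewrite mulr_suml; apply: eq_bigr => v _; rewrite /right /=.
    by have [->|/(flow_supp fG)[_ ->]] := eqVneq (G u v) 0; rewrite ?mul0r.
  have drop1 : 0 <= below_drop r s (r x).+1 (r x + s u).
    exact: below_drop_ge0 (total_rk (x, u)).
  have drop2 : 0 <= below_drop s r (s u).+1 (r x + s u).
    by apply: below_drop_ge0; rewrite ?(pair_totalC r s) ?(total_rk (x, u)).
  have rowF := ler_wpM2r (divr_ge0 drop1 (ler0n _ (rcount s 0 (s u)))) (flow_row fF x).
  have rowG := ler_wpM2r (divr_ge0 drop2 (ler0n _ (rcount r 0 (r x)))) (flow_row fG u).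
  apply: le_trans (lerD rowF rowG) _; rewrite le_eqVlt; apply/orP; left; apply/eqP.
  have p0 : (rcount r 0 (r x))%:R != 0 :> rat by rewrite pnatr_eq0 -lt0n rcount_gt0.
  have q0 : (rcount s 0 (s u))%:R != 0 :> rat by rewrite pnatr_eq0 -lt0n rcount_gt0.
  rewrite !(mulrCA _^-1) -[X in _ + _ * X]mulrC -mulrDl below_drop_source //; last first.
    exact: total_rk (x, u).
  by rewrite mulrAC -invfM mulfV ?mul1r // mulf_neq0.
- rewrite /= => yv0; rewrite -pair_total_prod big_split /= sum_snd_eq sum_fst_eq.
  have -> : \sum_x left (x, v) (y, v) = (\sum_x F x y) *
      (below_drop r s (r y) (r y + s v).-1 / (rcount s 0 (s v))%:R).
    rewrite mulr_suml; apply: eq_bigr => x _; rewrite /left /rk /=.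
    by have [->|/(flow_supp fF)[_ ->]] := eqVneq (F x y) 0; rewrite ?mul0r.
  have -> : \sum_u right (y, u) (y, v) = (\sum_u G u v) *
      (below_drop s r (s v) (r y + s v).-1 / (rcount r 0 (r y))%:R).
    rewrite mulr_suml; apply: eq_bigr => u _; rewrite /right /rk /=.
    by have [->|/(flow_supp fG)[_ ->]] := eqVneq (G u v) 0; rewrite ?mul0r ?addnS.
  have p0 : (rcount r 0 (r y))%:R != 0 :> rat by rewrite pnatr_eq0 -lt0n rcount_gt0.
  have q0 : (rcount s 0 (s v))%:R != 0 :> rat by rewrite pnatr_eq0 -lt0n rcount_gt0.
  set l := (r y + s v).-1; have el : (r y + s v = l.+1)%N by rewrite prednK.
  have tl1 : (0 < pair_total r s l.+1)%N by rewrite -el; exact: total_rk (y, v).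
  (* A coordinate of positive rank has a predecessor, which gives a pair on level [l]. *)
  have tl : (0 < pair_total r s l)%N.
    have [ry0|ry0] := posnP (r y).
      have sv0 : (0 < s v)%N by lia.
      have [u _ su] := flow_pred fG sv0.
      by have -> : l = rk (y, u) by rewrite /rk /=; lia.
    have [x _ rx] := flow_pred fF ry0.
    by have -> : l = rk (x, v) by rewrite /rk /=; lia.
  have drop1 : 0 <= below_drop r s (r y) l by exact: below_drop_ge0.
  have drop2 : 0 <= below_drop s r (s v) l by apply: below_drop_ge0; rewrite ?(pair_totalC r s).
  have colF : (rcount r 0 (r y))%:R^-1 * (below_drop r s (r y) l / (rcount s 0 (s v))%:R) <=
      (\sum_x F x y) * (below_drop r s (r y) l / (rcount s 0 (s v))%:R).
    (* At rank 0 the flow [F] gives no column bound, but there [below_drop] vanishes. *)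
    have [->|ry0] := posnP (r y); last first.
      by apply: ler_wpM2r (flow_col fF ry0); rewrite divr_ge0.
    by rewrite below_drop0 !(mul0r, mulr0).
  have colG : (rcount s 0 (s v))%:R^-1 * (below_drop s r (s v) l / (rcount r 0 (r y))%:R) <=
      (\sum_u G u v) * (below_drop s r (s v) l / (rcount r 0 (r y))%:R).
    have [->|sv0] := posnP (s v); last first.
      by apply: ler_wpM2r (flow_col fG sv0); rewrite divr_ge0.
    by rewrite below_drop0 !(mul0r, mulr0).
  apply: le_trans (lerD colF colG); rewrite le_eqVlt; apply/orP; left; apply/eqP.
  rewrite !(mulrCA _^-1) -[X in _ + _ * X]mulrC -mulrDl below_drop_target // -el.
  by rewrite mulrAC -invfM mulfV ?mul1r // mulf_neq0.
Qed.
End FlowProd.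

(* The class of posets to which Harper's product theorem applies. *)
Definition harper (X : finType) (le : rel X) (r : X -> nat) : Prop :=
  [/\ reflexive le, tp2 (rcount r) & exists F, flow le r F].

Lemma harper_prod (X Y : finType) (leX : rel X) (leY : rel Y)
    (r : X -> nat) (s : Y -> nat) :
  harper leX r -> harper leY s ->
  harper (fun p q : X * Y => leX p.1 q.1 && leY p.2 q.2)
         (fun p => r p.1 + s p.2)%N.
Proof.
move=> [reflX tr [F fF]] [reflY ts [G fG]]; split.
- by move=> p; rewrite reflX reflY.
- exact: tp2_prod.
- by exists (flow_prod r s F G); apply: flow_prodP.
Qed.

(** Equal ranks leave all marginals unchanged, and monotonicity of [f] keeps the support of the flow
    inside [leY]. *)
Lemma harper_bij (X Y : finType) (leX : rel X) (leY : rel Y)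
    (r : X -> nat) (s : Y -> nat) (f : X -> Y) :
  bijective f -> reflexive leY -> (forall x x', leX x x' -> leY (f x) (f x')) ->
  (forall x, s (f x) = r x) ->
  harper leX r -> harper leY s.
Proof.
move=> bij_f reflY le_f rf [_ tr [F fF]]; have [g fK gK] := bij_f.
have countE a l : rcount s a l = rcount r a l.
  rewrite /rcount (reindex f); last exact: onW_bij.
  by apply: eq_bigr => x _; rewrite rf.
split=> //; first by move=> a b i j ab ij; rewrite !countE tr.
have bij_g : bijective g by exists f.
have rg y : r (g y) = s y by rewrite -rf gK.
exists (fun y z => F (g y) (g z)); split=> [y z|y z|y|y].
- exact: flow_ge0 fF _ _.
- by case/(flow_supp fF) => /le_f; rewrite !gK !rg.
- rewrite countE -rg; apply: le_trans (flow_row fF (g y)).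
  by rewrite [leRHS](reindex g) //; apply: onW_bij.
- rewrite countE -rg => y0; apply: le_trans (flow_col fF y0) _.
  by rewrite [leLHS](reindex g) //; apply: onW_bij.
Qed.

(** * Powers of a poset *)

Definition tuple_le (X : finType) (le : rel X) n (s t : n.-tuple X) : bool :=
  [forall i, le (tnth s i) (tnth t i)].

Definition tuple_rank (X : finType) (r : X -> nat) n (t : n.-tuple X) : nat :=
  (\sum_(i < n) r (tnth t i))%N.

Lemma harper_tuple (X : finType) (le : rel X) (r : X -> nat) n :
  harper le r -> harper (@tuple_le X le n) (@tuple_rank X r n).
Proof.
move=> hX; have [reflX _ _] := hX; elim: n => [|n IHn].
  (* The only empty tuple has rank 0, so the Toeplitz matrix is the identity and the zero flow
     qualifies. *)
  have count0 a l : rcount (@tuple_rank X r 0) a l = (a == l).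
    rewrite /rcount (eq_bigr (fun=> (a == l) : nat)) => [|t _].
      by rewrite sum_nat_const card_tuple expn0 mul1n.
    by rewrite /tuple_rank big_ord0 addn0.
  split; first by move=> t; apply/forallP.
    by move=> a b i j ab ij; rewrite !count0 !mulnb; lia.
  exists (fun _ _ => 0); split=> [//|s t|t|t]; rewrite ?eqxx //.
    by rewrite big1 // invr_ge0.
  by rewrite /tuple_rank big_ord0.
apply: (harper_bij (f := fun p : X * n.-tuple X => [tuple of p.1 :: p.2]) _ _ _ _
  (harper_prod hX IHn)).
- exists (fun t => (thead t, [tuple of behead t])) => [[x t]|t].
    by congr pair; apply: val_inj.
  by rewrite [RHS]tuple_eta.
- by move=> t; apply/forallP.
- move=> [x s] [y t] /andP[/= xy /forallP st]; apply/forallP => i.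
  by case: (unliftP ord0 i) => [j|] ->; rewrite ?tnthS ?tnth0.
- move=> [x t]; rewrite /tuple_rank big_ord_recl tnth0; congr addn.
  by apply: eq_bigr => i _; rewrite tnthS.
Qed.

Lemma sum_ord_eq n c : (\sum_(i < n) (i == c :> nat) = (c < n))%N.
Proof.
have [cn|nc] := ltnP c n; last first.
  by apply: big1 => i _; apply/eqP; rewrite eqb0; have := ltn_ord i; lia.
rewrite (bigD1 (Ordinal cn)) //= eqxx big1 // => i.
by rewrite -(inj_eq val_inj) /= => /negbTE->.
Qed.

(** * The spider with two legs *)

Section Spider.
Variable k : nat.
Local Notation leg := 'I_(k + k).+1.

(* The spider with two legs of length [k] is encoded as [0, 2k], with bottom [k]. *)
Definition spider_rank (t : leg) : nat := ((t - k) + (k - t))%N.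

(** With truncated subtraction, [t - k] and [k - t] are the heights on the two legs, at most one
    being nonzero. *)
Definition spider_le (s t : leg) : bool :=
  ((s - k <= t - k) && (k - s <= k - t))%N.

Lemma spider_count a l : rcount spider_rank a l =
  (if (a <= l <= k + a)%N then if (a < l)%N then 2 else 1 else 0)%N.
Proof.
case: ifP => ale; last first.
  by apply: big1 => t _; rewrite /spider_rank; have := ltn_ord t; lia.
case: ifP => al; last first.
  rewrite -[RHS](_ : (k < (k + k).+1)%N = 1 :> nat); last by rewrite ltnS leq_addr.
  by rewrite -sum_ord_eq; apply: eq_bigr => t _; rewrite /spider_rank; lia.
(* The two elements of rank [l - a], one on each leg. *)
rewrite -[RHS](_ : (k + a - l < (k + k).+1) + (k + l - a < (k + k).+1) = 2)%N; last by lia.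
rewrite -!sum_ord_eq -big_split; apply: eq_bigr => t _ /=.
by rewrite /spider_rank; lia.
Qed.

(** The bottom splits its mass 1 evenly between the legs, and each half then climbs its leg. *)
Definition spider_flow (s t : leg) : rat :=
  if spider_le s t && (spider_rank t == (spider_rank s).+1) then 2^-1 else 0.

Lemma spider_flowP : flow spider_le spider_rank spider_flow.
Proof.
have rk_le t : (spider_rank t <= k)%N by rewrite /spider_rank; have := ltn_ord t; lia.
split=> [s t|s t|s|t t0]; rewrite ?spider_count ?addn0 ?leq0n ?rk_le ?andbT ?t0.
- by rewrite /spider_flow; case: ifP.
- by rewrite /spider_flow; case: ifP => [/andP[? /eqP]|_ /eqP].
- have -> : \sum_t spider_flow s t =
      (\sum_t (spider_le s t && (spider_rank t == (spider_rank s).+1)))%:R / 2.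
    rewrite natr_sum mulr_suml; apply: eq_bigr => t _; rewrite /spider_flow.
    by case: ifP; rewrite ?mul1r ?mul0r.
  rewrite -[leRHS](mulfK (_ : 2 != 0)) // ler_pM2r ?invr_gt0 //.
  (* The bound on the number of upper covers is 2 at the bottom [k] and 1 elsewhere. *)
  suff le_deg : (\sum_t (spider_le s t && (spider_rank t == (spider_rank s).+1))
      <= (k <= s) + (s <= k))%N.
    apply: le_trans (_ : ((k <= s) + (s <= k))%N%:R <= _); first by rewrite ler_nat.
    case: ifP; rewrite /spider_rank => h.
      by rewrite mulVf // (ler_nat _ _ 1); lia.
    by rewrite invr1 mul1r ler_nat; lia.
  apply: leq_trans (_ : (\sum_(t : leg) ((k <= s) * (t == s.+1 :> nat)
      + (s <= k) * (t == s.-1 :> nat)) <= _)%N).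
    apply: leq_sum => t _; rewrite /spider_le /spider_rank !mulnb; lia.
  rewrite big_split -!big_distrr /= !sum_ord_eq; lia.
- have [s_lt lst] : exists s : leg, spider_le s t && (spider_rank t == (spider_rank s).+1).
    have tk := ltn_ord t; rewrite /spider_le /spider_rank in t0 *.
    have [lt_tk|le_kt] := ltnP t k.
      by exists (inord t.+1); rewrite inordK; lia.
    by exists (inord t.-1); rewrite inordK; lia.
  rewrite (bigD1 s_lt) //= {1}/spider_flow lst lerDl; apply: sumr_ge0 => s _.
  by rewrite /spider_flow; case: ifP.
Qed.

Lemma harper_spider : harper spider_le spider_rank.
Proof.
split; last by exists spider_flow; apply: spider_flowP.
- by move=> t; rewrite /spider_le !leqnn.
- move=> a b i j ab ij; rewrite !spider_count.
  by do 4!case: ifP => [? | ?]; do ?case: ifP => [? | ?]; lia.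
Qed.

End Spider.

(** * Multichains of flags as tuples of spider elements *)

Lemma sum_suffix k a : (a <= k)%N -> (\sum_(j < k) (k <= j + a) = a)%N.
Proof.
elim: k a => [|k IHk] [|a] ak //; first by rewrite big_ord0.
  by apply: big1 => j _; have := ltn_ord j; lia.
rewrite big_ord_recr /= -[RHS]addn1 -[in RHS](IHk a) //; congr addn; last by lia.
by apply: eq_bigr => j _; rewrite addnS.
Qed.

(** If [u j] holds, so does [u] at all [k - j] indices from [j] on; if not, [u] holds only beyond
    [j], at fewer than [k - j] indices. *)
Lemma upset_suffix k (u : 'I_k -> bool) (j : 'I_k) :
  (forall i i' : 'I_k, (i <= i')%N -> u i -> u i') ->
  u j = (k <= j + \sum_(i < k) u i)%N.
Proof.
move=> up; have jk := ltn_ord j; apply/idP/idP => [uj|]; last apply: contraTT => uj.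
  rewrite -leq_subLR -[leqLHS](@sum_suffix k) ?leq_subr //.
  apply: leq_sum => i _; case: (leqP k) => // ki.
  by rewrite (up j i) //; lia.
rewrite -ltnNge -ltn_subRL; apply: leq_ltn_trans (_ : (k - j).-1 < _)%N; last by lia.
rewrite -[leqRHS](@sum_suffix k); last by lia.
apply: leq_sum => i _; case: (boolP (u i)) => // ui; case: (leqP k) => // ki.
by case/negP: uj; apply: up ui; lia.
Qed.

Section IsoFlagChain.
Variables n k : nat.
Local Notation leg := 'I_(k + k).+1.
Local Notation chain := (multichain (isoFlag n) k).

(** Members of a multichain increase, so an element with multiplicity [a] lies in exactly the last
    [a] of them. *)
Definition leg_set (t : n.-tuple leg) (j : nat) : {set 'I_n + 'I_n} :=
  [set z | match z with
           | inl i => k <= j + (tnth t i - k)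
           | inr i => k <= j + (k - tnth t i)
           end%N].

Lemma leg_set_isotropic t (j : 'I_k) : isotropic (leg_set t j).
Proof. by apply/forallP => i; rewrite !inE; have := ltn_ord j; lia. Qed.

Definition leg_flag t (j : 'I_k) : isoFlag n := IsoFlag (leg_set_isotropic t j).

Lemma leg_flag_homo t (i j : 'I_k) : (i <= j)%N -> (leg_flag t i <= leg_flag t j)%O.
Proof.
by move=> ij; rewrite iso_leE; apply/subsetP => -[] z; rewrite !inE; lia.
Qed.

Definition leg_chain t : chain := mk_mc (@leg_flag_homo t).

Definition multiplicity (c : chain) (z : 'I_n + 'I_n) : nat :=
  (\sum_(j < k) (z \in iso_set (mc_nth c j)))%N.

Lemma mem_multiplicity (c : chain) z j :
  (z \in iso_set (mc_nth c j)) = (k <= j + multiplicity c z)%N.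
Proof.
apply: (upset_suffix (u := fun j => z \in iso_set (mc_nth c j))) => i i' ii'.
by apply/subsetP; rewrite -iso_leE mc_nth_homo.
Qed.

Lemma multiplicity_le (c : chain) z : (multiplicity c z <= k)%N.
Proof.
rewrite -[leqRHS]card_ord -sum1_card; apply: leq_sum => j _; exact: leq_b1.
Qed.

(** Otherwise the last member of the chain would contain both i and i'. *)
Lemma multiplicity_isotropic (c : chain) i :
  multiplicity c (inl i) = 0%N \/ multiplicity c (inr i) = 0%N.
Proof.
case: (posnP (multiplicity c (inl i))) => [|a0]; first by left.
case: (posnP (multiplicity c (inr i))) => [|b0]; first by right.
have ak := multiplicity_le c (inl i).
have lt_k : (k.-1 < k)%N by lia.
have /forallP/(_ i) := iso_setP (mc_nth c (Ordinal lt_k)).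
by rewrite !mem_multiplicity /=; lia.
Qed.

Lemma multiplicity_leg_chain t z : multiplicity (leg_chain t) z =
  match z with inl i => tnth t i - k | inr i => k - tnth t i end%N.
Proof.
rewrite /multiplicity; under eq_bigr do rewrite mk_mcE inE.
by case: z => i; rewrite sum_suffix //; have := ltn_ord (tnth t i); lia.
Qed.

Definition chain_leg (c : chain) : n.-tuple leg :=
  [tuple inord (k + multiplicity c (inl i) - multiplicity c (inr i)) | i < n].

Lemma chain_legE c i : tnth (chain_leg c) i =
  (k + multiplicity c (inl i) - multiplicity c (inr i))%N :> nat.
Proof.
by rewrite tnth_mktuple inordK //; have := multiplicity_le c (inl i); lia.
Qed.

Lemma leg_chainK : cancel leg_chain chain_leg.
Proof.
move=> t; apply: eq_from_tnth => i; apply: val_inj.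
by rewrite /= chain_legE !multiplicity_leg_chain; lia.
Qed.

Lemma chain_legK : cancel chain_leg leg_chain.
Proof.
move=> c; apply: mc_nth_inj => j; apply: val_inj; apply/setP; move: j.
suff mem_eq (j : 'I_k) (z : 'I_n + 'I_n) :
    (z \in iso_set (mc_nth (leg_chain (chain_leg c)) j)) =
    (z \in iso_set (mc_nth c j)) by move=> j z; apply: mem_eq.
rewrite !mem_multiplicity multiplicity_leg_chain.
case: z => i; rewrite chain_legE; have := multiplicity_le c (inr i);
  by case: (multiplicity_isotropic c i); lia.
Qed.

(** Double counting of the incidences between members of the chain and their elements. *)
Lemma prank_leg_chain t :
  prank (leg_chain t) = tuple_rank (@spider_rank k) t.
Proof.
transitivity (\sum_z multiplicity (leg_chain t) z)%N.
  rewrite exchange_big; apply: eq_bigr => j _.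
  rewrite -[LHS]/(iso_rank _) /iso_rank -sum1_card big_mkcond; apply: eq_bigr => z _.
  by case: (z \in _).
rewrite big_sumType /= -big_split; apply: eq_bigr => i _ /=.
by rewrite !multiplicity_leg_chain.
Qed.

Lemma leg_chain_le (s t : n.-tuple leg) : tuple_le (@spider_le k) s t -> (leg_chain s <= leg_chain t)%O.
Proof.
move=> /forallP st; have {}st (i : 'I_n) : spider_le (tnth s i) (tnth t i) := st i.
apply/mc_leP => j; rewrite !mk_mcE iso_leE; apply/subsetP.
suff sub (z : 'I_n + 'I_n) : z \in leg_set s j -> z \in leg_set t j by [].
by case: z => i; rewrite !inE; have := st i; rewrite /spider_le; lia.
Qed.

Lemma harper_isoFlag_chain : harper (<=%O : rel chain) prank.
Proof.
apply: (harper_bij (f := leg_chain) _ _ leg_chain_le prank_leg_chain).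
- by exists chain_leg; [exact: leg_chainK | exact: chain_legK].
- exact: lexx.
- exact: harper_tuple (harper_spider k).
Qed.

End IsoFlagChain.

(** * From flows to the LYM inequality and the strong Sperner property *)

(** The elements of positive rank in the down-set of [A] weigh at most the flow into it, which
    starts in the down-set minus [A]. So [A] weighs at most as much as the rank 0 part, hence at
    most 1. *)
Lemma harper_LYM (X : finType) (le : rel X) (r : X -> nat) (A : {set X}) :
  harper le r -> transitive le -> antisymmetric le ->
  {in A &, forall x y, le x y -> x = y} ->
  \sum_(x in A) (rcount r 0 (r x))%:R^-1 <= 1 :> rat.
Proof.
move=> [refl_le _ [F fF]] tr_le asym_le anti.
(* In the down-set [D] of [A], flow into [D] never starts in [A]. *)
pose D := [set x | [exists a in A, le x a]].
have AD x : x \in A -> x \in D by move=> xA; rewrite inE; apply/existsP; exists x; rewrite xA refl_le.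
pose w x : rat := (rcount r 0 (r x))%:R^-1.
have w0 x : 0 <= w x by rewrite invr_ge0.
have flow_D : \sum_(y in D | (0 < r y)%N) w y <= \sum_(x in D :\: A) w x.
  apply: (@le_trans _ _ (\sum_(y in D) \sum_x F x y)).
    rewrite big_mkcondr; apply: ler_sum => y yD; case: ifP => [y0|_].
      exact: (flow_col fF y0).
    by apply: sumr_ge0 => x _; apply: (flow_ge0 fF).
  rewrite exchange_big (bigID (mem (D :\: A))) /= addrC big1 ?add0r => [|x xDA].
    apply: ler_sum => x _; apply: le_trans (flow_row fF x).
    by rewrite big_mkcond; apply: ler_sum => y _; case: ifP => // _; apply: (flow_ge0 fF).
  apply: big1 => y; rewrite inE => /existsP[a /andP[aA ya]].
  apply/eqP; apply: contraNT xDA => /(flow_supp fF)[xy rxy].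
  have xa := tr_le _ _ _ xy ya; rewrite in_setD inE andbC.
  apply/andP; split; first by apply/existsP; exists a; rewrite aA xa.
  apply/negP => xA; have ex := anti _ _ xA aA xa.
  have e : x = y by apply: asym_le; rewrite xy [in X in _ && X]ex.
  by move: rxy; rewrite e; lia.
have sub_AD : A \subset D by apply/subsetP.
have split_D : \sum_(x in D) w x = \sum_(x in A) w x + \sum_(x in D :\: A) w x.
  by rewrite (big_setID A) (setIidPr sub_AD).
have bottom : \sum_(x in D | ~~ (0 < r x)%N) w x <= 1.
  have le_tot : \sum_(x in D | ~~ (0 < r x)%N) w x
      <= \sum_(x : X) (0 + r x == 0 :> nat)%:R / (rcount r 0 0)%:R.
    rewrite big_mkcond; apply: ler_sum => x _; case: ifP => [/andP[_ ]|_].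
      by rewrite -eqn0Ngt => /eqP e0; rewrite /w e0 mul1r.
    by rewrite divr_ge0.
  apply: le_trans le_tot _; rewrite -mulr_suml -natr_sum -/(rcount r 0 0).
  by have [->|c0] := posnP (rcount r 0 0); rewrite ?mul0r // divff // pnatr_eq0 -lt0n.
have : \sum_(x in D) w x =
    \sum_(x in D | (0 < r x)%N) w x + \sum_(x in D | ~~ (0 < r x)%N) w x.
  exact: bigID.
rewrite split_D.
by move: bottom flow_D; lra.
Qed.

Lemma mem_bigcup_seq (T : finType) (t : seq {set T}) x :
  (x \in \bigcup_(L <- t) L) = has (fun L : {set T} => x \in L) t.
Proof. by elim: t => [|L t IHt]; rewrite ?big_nil ?inE // big_cons inE IHt. Qed.

Section GradedHarper.
Context {d : Order.disp_t} (P : gradedPosetType d).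
Hypothesis hP : harper (<=%O : rel P) prank.

Lemma card_level i : #|level P i| = rcount (@prank d P) 0 i.
Proof.
rewrite -sum1_card big_mkcond; apply: eq_bigr => x _.
by rewrite inE add0n; case: eqP.
Qed.

Lemma harper_rank_log_concave : rank_log_concave P.
Proof.
move=> i /andP[i0 _]; have [_ tP _] := hP; rewrite !card_level.
(* The minor with rows 0, 1 and columns [i], [i + 1]. *)
have := tP 0 1 i i.+1 isT (leqnSn i); rewrite !(rcountE _ 1) i0 subn1 subn1 /=.
by rewrite -mulnn.
Qed.

(** Descent by [flow_pred] from an element of maximal rank. Nonempty levels are pairwise distinct
    sets, each of total weight 1. *)
Lemma level_neq0 (x0 : P) i : (i <= height P)%N -> level P i != set0.
Proof.
have [_ _ [F fF]] := hP; have P_gt0 : (0 < #|{: P}|)%N by apply/card_gt0P; exists x0.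
rewrite /height; have [x ->] := bigop.eq_bigmax (@prank d P) P_gt0 => ih; apply/set0Pn.
elim: {x}_.+1 {-2}x (ltnSn (prank x)) ih => // m IHm x xm.
rewrite leq_eqVlt => /orP[/eqP->|ix]; first by exists x; rewrite inE.
have x_gt0 : (0 < prank x)%N by lia.
by have [y _ xy] := flow_pred fF x_gt0; apply: (IHm y); lia.
Qed.

Lemma harper_strong_sperner : strong_sperner P.
Proof.
move=> m A anti; have [P0|/card_gt0P[x0 _]] := posnP #|{: P}|.
  by apply: leq_trans (max_card _) _; rewrite P0.
rewrite /largest_levels; set s := levels_by_size P.
have mem_s (x : P) : level P (prank x) \in s.
  by rewrite mem_sort map_f // mem_iota add0n ltnS /=; exact: (bigop.leq_bigmax x).
have uniq_s : uniq s.
  rewrite sort_uniq map_inj_in_uniq ?iota_uniq // => i j.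
  rewrite !mem_iota !add0n !ltnS => ih jh /setP eij.
  have /set0Pn[x xi] := level_neq0 x0 ih; have := eij x.
  by move: xi; rewrite !inE => /eqP->; rewrite eqxx => /esym/eqP.
have in_s L (x : P) : L \in s -> (x \in L) = (L == level P (prank x)).
  rewrite mem_sort => /mapP[i _ ->]; rewrite inE; apply/eqP/eqP => [->//|/setP/(_ x)].
  by rewrite !inE eqxx => /eqP.
pose t := take m s; pose G := \bigcup_(L <- t) L; rewrite -/t -/G.
have ts L : L \in t -> L \in s by apply: mem_take.
have mem_G x : (x \in G) = (level P (prank x) \in t).
  rewrite mem_bigcup_seq -has_pred1; apply: eq_in_has => L Lt.
  by rewrite in_s ?ts.
pose w (x : P) : rat := #|level P (prank x)|%:R^-1.
have card_gt0 (x : P) : 0 < #|level P (prank x)|%:R :> rat.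
  by rewrite ltr0n; apply/card_gt0P; exists x; rewrite inE.
have w_ge0 x : 0 <= w x by rewrite invr_ge0.
pose F := \bigcup_(j < m) A j; rewrite -/F.
have LYM : \sum_(x in F) w x <= m%:R.
  apply: (@le_trans _ _ (\sum_(j < m) \sum_(x in A j) w x)).
    under [leRHS]eq_bigr do rewrite big_mkcond.
    rewrite exchange_big big_mkcond; apply: ler_sum => x _.
    case: ifP => [/bigcupP[j _ xj]|_]; last by apply: sumr_ge0 => j _; case: ifP.
    by rewrite (bigD1 j) //= xj lerDl; apply: sumr_ge0 => i _; case: ifP.
  rewrite -[leRHS](_ : \sum_(j < m) 1 = _); last by rewrite sumr_const card_ord.
  apply: ler_sum => j _; under eq_bigr do rewrite /w card_level.
  exact: (harper_LYM hP le_trans le_anti (anti j)).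
have [sm|ms] := leqP (size s) m.
  by apply: subset_leq_card; apply/subsetP => x _; rewrite mem_G /t take_oversize.
(* The size of the first level left out of [G]: a threshold between the levels chosen and the
   others. *)
pose lam : rat := #|nth set0 s m|%:R.
have sorted_s : {in gtn (size s) &, forall i j, (i <= j)%N ->
    (#|nth set0 s j| <= #|nth set0 s i|)%N}.
  pose geq_card (B C : {set P}) := (#|C| <= #|B|)%N.
  have geq_trans : transitive geq_card by move=> B C D BC DB; apply: leq_trans DB BC.
  have geq_refl : reflexive geq_card by move=> B; apply: leqnn.
  apply: (sorted_leq_nth geq_trans geq_refl).
  by apply: sort_sorted => B C; apply: leq_total.
have G_index x : (x \in G) = (index (level P (prank x)) s < m)%N.
  by rewrite mem_G in_take.
have lam_w x : if x \in G then lam * w x <= 1 else 1 <= lam * w x.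
  have xs := mem_s x; rewrite G_index -[w x]/(_^-1); case: ifP => [im|/negbT].
    rewrite ler_pdivrMr // mul1r ler_nat -[in leqRHS](nth_index set0 xs).
    by apply: sorted_s; rewrite ?inE ?index_mem // ltnW.
  rewrite -leqNgt => mi; rewrite ler_pdivlMr // mul1r ler_nat.
  by rewrite -[in leqLHS](nth_index set0 xs) sorted_s ?inE ?index_mem.
(* [G] consists of [m] whole levels, each of weight 1, so it attains the LYM bound for [F]. *)
have weight_G : \sum_(x in G) w x = m%:R.
  transitivity (\sum_(L <- t) \sum_(x in L) w x).
    under [RHS]eq_bigr do rewrite big_mkcond.
    rewrite exchange_big big_mkcond; apply: eq_bigr => x _; rewrite -big_mkcond.
    rewrite big_const_seq iter_addr_0.
    rewrite (_ : count _ t = (x \in G)); first by case: ifP.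
    rewrite mem_G -(count_uniq_mem _ (take_uniq m uniq_s)).
    by apply: eq_in_count => L Lt; rewrite in_s ?ts.
  rewrite (eq_big_seq (fun=> 1)) => [|L Lt].
    by rewrite big_const_seq count_predT iter_addr_0 size_takel // ltnW.
  have Ls := ts _ Lt.
  rewrite (eq_bigr (fun=> #|L|%:R^-1)) => [|x]; last by rewrite in_s // => /eqP->.
  rewrite sumr_const -[LHS]mulr_natr mulVf // pnatr_eq0 cards_eq0.
  move: Ls; rewrite mem_sort => /mapP[i]; rewrite mem_iota add0n ltnS => ih ->.
  exact: (level_neq0 x0 ih).
rewrite -(ler_nat rat).
(* Pointwise: [lam * w x] is at most 1 on the largest levels [G] and at least 1
   elsewhere. *)
have le_card : #|F|%:R <= lam * (\sum_(x in F) w x) + (#|G|%:R - lam * \sum_(x in G) w x).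
  rewrite -!sum1_card !natr_sum !mulr_sumr -sumrB.
  rewrite [leLHS]big_mkcond [X in _ <= X + _]big_mkcond [X in _ <= _ + X]big_mkcond.
  rewrite -big_split; apply: ler_sum => x _ /=; have := lam_w x.
  by do 2!case: ifP => _; lra.
have lam0 : 0 <= lam by rewrite ler0n.
by have := ler_wpM2l lam0 LYM; move: le_card; rewrite weight_G; lra.
Qed.
End GradedHarper.

Theorem theorem2p14 (n k : nat) :
  strong_sperner (multichain (isoFlag n) k) /\
  rank_log_concave (multichain (isoFlag n) k).
Proof.
have chain_harper := @harper_isoFlag_chain n k.
by split; [apply: harper_strong_sperner | apply: harper_rank_log_concave].
Qed.
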